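(* Fix a real number $Q>1$ and set $q=-Q$. For $\Re s>1$, $$\sum_{n\ge2}\frac{\mathfrak S(n,-Q)}{n^s}=Q(Q+1)\,\zeta(s)\,\Big(\frac1Q-\eta_Q(s)\Big),\qquad \sum_{n\ge2}\frac{\mathfrak F(n,-Q)}{n^s}=Q(Q+1)\,(\zeta(s)-1)\,\Big(\frac1Q-\eta_Q(s)\Big),$$ where $\eta_Q(s)=\sum_{n\ge1}(-1)^{n-1}Q^{-n}n^{-s}$. In particular, the only singularity at $s=1$ comes from the factor $\zeta(s)$ (respectively $\zeta(s)-1$), and no Abel summation is required since $|1/q|<1$.
   Context: For $z\in\mathbb C$ and an integer $i\ge2$, $F(z,i)=i+2\sum_{k=1}^{i-1}(i-k)\cos(2\pi kz/i)$. For $q=-Q$ with $Q>1$ (so $(q-1)q=Q(Q+1)$), $$\mathfrak S(z,-Q)=Q(Q+1)\sum_{i\ge2}\frac{F(z,i)}{i^2}(-Q)^{-i},\qquad \mathfrak F(z,-Q)=\mathfrak S(z,-Q)-Q(Q+1)(-Q)^{-z},$$ with $(-Q)^{-z}$ defined by the principal logarithm (branch-independent at integers). The function $\eta_Q$ is entire in $s$. $\zeta$ is the Riemann zeta function. *)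

(* Defs.v *)
From Stdlib Require Import Reals.
From Coquelicot Require Import Coquelicot.

Open Scope R_scope.

(** * Complex exponential, principal logarithm, principal powers *)

Definition Cexp (z : C) : C := (exp (Re z) * cos (Im z), exp (Re z) * sin (Im z)).

Definition Ccos (z : C) : C := ((Cexp (Ci * z) + Cexp (- (Ci * z))) / 2)%C.

(* Principal argument, in (-PI, PI]; it is PI on the negative real axis. *)
Definition Carg (z : C) : R :=
  if Rle_dec 0 (Im z) then acos (Re z / Cmod z) else - acos (Re z / Cmod z).

Definition Clog (z : C) : C := (ln (Cmod z), Carg z).

(* [w] to the power [z], meaningful for [w <> 0] only. *)
Definition Cpower (w z : C) : C := Cexp (z * Clog w)%C.

(** * Sums of complex series *)

(* As with [Series], the value is only meaningful for convergent series. *)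
Definition CSeries (a : nat -> C) : C :=
  (Series (fun n => Re (a n)), Series (fun n => Im (a n))).

Definition abs_summable (a : nat -> C) : Prop := ex_series (fun n => Cmod (a n)).

(** * Holomorphy and singularities *)

Definition holomorphic_at (f : C -> C) (a : C) : Prop :=
  @locally C_UniformSpace a (fun z => ex_derive f z).

Definition entire (f : C -> C) : Prop := forall z : C, holomorphic_at f z.

(* [a] is neither a regular point nor a removable singularity of [f]; the value
   of [f] at [a] plays no role. *)
Definition singular_at (f : C -> C) (a : C) : Prop :=
  ~ exists g : C -> C,
      holomorphic_at g a /\ @locally' C_UniformSpace a (fun z => g z = f z).

(** * The Riemann zeta function *)

(* The Dirichlet series, for [1 < Re s]. *)
Definition zeta (s : C) : C :=
  CSeries (fun n => (1 / Cpower (INR (n + 1)) s)%C).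

(* [Z] is the Riemann zeta function on the whole plane: the analytic continuation
   of the Dirichlet series to the plane without 1 (unique by the identity theorem;
   the value [Z 1] is irrelevant). *)
Definition is_riemann_zeta (Z : C -> C) : Prop :=
  (forall s : C, 1 < Re s -> Z s = zeta s) /\
  (forall s : C, s <> RtoC 1 -> holomorphic_at Z s).

(** * The functions F, frakS, frakF, eta *)

Definition F (z : C) (i : nat) : C :=
  (INR i + 2 * sum_n_m (fun k => INR (i - k) * Ccos (2 * PI * INR k * z / INR i)) 1 (i - 1))%C.

(* The term of index [i] of the series defining [frakS z Q]. *)
Definition frakS_term (z : C) (Q : R) (i : nat) : C :=
  (F z i / INR i ^ 2 * RtoC (/ (- Q) ^ i))%C.

(* The values at [q = - Q], for which [(q - 1) * q = Q * (Q + 1)]. *)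
Definition frakS (z : C) (Q : R) : C :=
  (RtoC (Q * (Q + 1)) * CSeries (fun n => frakS_term z Q (n + 2)))%C.

Definition frakF (z : C) (Q : R) : C :=
  (frakS z Q - RtoC (Q * (Q + 1)) * Cpower (- Q)%R (- z))%C.

Definition eta_term (Q : R) (s : C) (n : nat) : C :=
  (RtoC ((-1) ^ (n - 1) * / Q ^ n) / Cpower (INR n) s)%C.

Definition eta (Q : R) (s : C) : C := CSeries (fun n => eta_term Q s (n + 1)).

(* Main.v *)
Require Import Defs.
From Stdlib Require Import Reals Lra Lia Psatz Arith.
From Coquelicot Require Import Coquelicot.

Open Scope R_scope.

(** Write K = Q (Q + 1) and c_i = (-Q)^(-i).

    For integers n and i >= 1, F(n, i) / i^2 is a normalised Fejer kernel at the
    frequency n / i: it is 1 when i divides n and 0 otherwise ([F_INR_divide],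
    [F_INR_not_divide]).  So frakS(n) is K times the sum of c_i over the
    divisors i >= 2 of n, and its Dirichlet series is a Dirichlet convolution:
    it should be K zeta(s) times the sum over i >= 2 of c_i i^(-s).  Since
    (-1)^(n-1) Q^(-n) = - c_n, that last sum is 1/Q - eta_Q(s) ([eta_tail]).
    The interchange of summations is [divisor_sum_dirichlet].  Up to n = N the
    double sum is the sum over i of c_i i^(-s) B(N / i), where B is the
    sequence of partial sums of zeta(s) and N / i is rounded down.  As B is
    bounded and tends to zeta(s), dominated convergence for series ([tannery])
    gives the limit.  In frakF(n), the subtracted term K (-Q)^(-n) is the
    contribution of the divisor i = n; summed against n^(-s) it gives
    K (1/Q - eta_Q(s)), which turns zeta(s) into zeta(s) - 1.

    The coefficients of eta_Q decay geometrically, hence faster than every power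
    of n, so its Dirichlet series can be differentiated termwise at every s
    ([ex_derive_dirichlet_series]); the remainder is controlled by
    |e^w - 1 - w| <= 4 e^|w| |w|^2.  So eta_Q is entire, and the right-hand
    sides are holomorphic wherever zeta is.

    At s = 1 two facts produce a singularity ([singular_at_product]): the factor
    1/Q - eta_Q(1) is not 0, because eta_Q(1) = 1/Q - 1/(2 Q^2) + ... is an
    alternating series whose terms decrease in absolute value ([eta_1_lt]); and
    zeta(1 + t) >= 1/t for t > 0, by comparison with a telescoping series
    ([Re_zeta_ge]).  A function agreeing with the product near 1 is therefore
    unbounded there, so it is not even continuous at 1. *)

(** * Series of complex numbers *)

Lemma im_le_Cmod (c : C) : Rabs (Im c) <= Cmod c.
Proof. apply Rle_trans with (2 := Rmax_Cmod c). apply Rmax_r. Qed.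

Lemma Cmod_le_Re_Im (c : C) : Cmod c <= Rabs (Re c) + Rabs (Im c).
Proof.
rewrite <- (Rabs_pos_eq (Cmod c)) by apply Cmod_ge_0.
rewrite <- (Rabs_pos_eq (Rabs (Re c) + Rabs (Im c))).
2: generalize (Rabs_pos (Re c)) (Rabs_pos (Im c)); lra.
apply Rsqr_le_abs_0. unfold Rsqr.
replace (Cmod c * Cmod c) with (Cmod c ^ 2) by ring.
rewrite Cmod2_alt, <- (pow2_abs (Re c)), <- (pow2_abs (Im c)).
generalize (Rabs_pos (Re c)) (Rabs_pos (Im c)); nra.
Qed.

Lemma Re_sum_n (a : nat -> C) (n : nat) : Re (sum_n a n) = sum_n (fun k => Re (a k)) n.
Proof.
induction n as [|n IH]; [now rewrite !sum_O|].
rewrite !sum_Sn, <- IH. reflexivity.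
Qed.

Lemma Im_sum_n (a : nat -> C) (n : nat) : Im (sum_n a n) = sum_n (fun k => Im (a k)) n.
Proof.
induction n as [|n IH]; [now rewrite !sum_O|].
rewrite !sum_Sn, <- IH. reflexivity.
Qed.

Lemma filterlim_C_components (u : nat -> C) (l : C) :
  filterlim u eventually (@locally C_UniformSpace l) <->
  is_lim_seq (fun n => Re (u n)) (Re l) /\ is_lim_seq (fun n => Im (u n)) (Im l).
Proof.
split.
- intros H; split; apply is_lim_seq_spec; intros eps;
  destruct (proj1 (filterlim_locally _ _) H eps) as [N HN]; exists N; intros n Hn;
  apply (HN n Hn).
- intros [H1 H2]. apply filterlim_locally. intros eps.
  apply is_lim_seq_spec in H1, H2.
  destruct (H1 eps) as [N1 HN1], (H2 eps) as [N2 HN2].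
  exists (max N1 N2). intros n Hn. split; [apply HN1 | apply HN2]; lia.
Qed.

Lemma is_series_C_components (a : nat -> C) (l : C) :
  is_series a l <->
  is_series (fun n => Re (a n)) (Re l) /\ is_series (fun n => Im (a n)) (Im l).
Proof.
unfold is_series at 1.
assert (H := filterlim_C_components (sum_n a) l).
split.
- intros Hl. apply H in Hl. destruct Hl as [H1 H2]. split.
  + apply (is_lim_seq_ext _ _ (Re l) (Re_sum_n a) H1).
  + apply (is_lim_seq_ext _ _ (Im l) (Im_sum_n a) H2).
- intros [H1 H2]. apply H. split.
  + apply (is_lim_seq_ext _ _ (Re l) (fun n => eq_sym (Re_sum_n a n)) H1).
  + apply (is_lim_seq_ext _ _ (Im l) (fun n => eq_sym (Im_sum_n a n)) H2).
Qed.

Lemma CSeries_unique (a : nat -> C) (l : C) : is_series a l -> CSeries a = l.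
Proof.
intros H. apply is_series_C_components in H. destruct H as [H1 H2].
unfold CSeries. rewrite (is_series_unique _ _ H1), (is_series_unique _ _ H2).
now destruct l.
Qed.

Lemma CSeries_ext (a b : nat -> C) : (forall n, a n = b n) -> CSeries a = CSeries b.
Proof.
intros H. unfold CSeries. f_equal; apply Series_ext; intros n; now rewrite H.
Qed.

Lemma abs_summable_le (a : nat -> C) (m : nat -> R) :
  (forall n, Cmod (a n) <= m n) -> ex_series m -> abs_summable a.
Proof.
intros H Hm. apply (ex_series_le (K := R_AbsRing) (V := R_CompleteNormedModule) _ m); [|exact Hm].
intros n. change (Rabs (Cmod (a n)) <= m n).
now rewrite Rabs_pos_eq by apply Cmod_ge_0.
Qed.

Lemma abs_summable_Re (a : nat -> C) :
  abs_summable a -> ex_series (fun n => Rabs (Re (a n))).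
Proof.
intros H. apply (ex_series_le (K := R_AbsRing) (V := R_CompleteNormedModule) _ (fun n => Cmod (a n))); [|exact H].
intros n. change (Rabs (Rabs (Re (a n))) <= Cmod (a n)).
rewrite Rabs_Rabsolu. apply re_le_Cmod.
Qed.

Lemma abs_summable_Im (a : nat -> C) :
  abs_summable a -> ex_series (fun n => Rabs (Im (a n))).
Proof.
intros H. apply (ex_series_le (K := R_AbsRing) (V := R_CompleteNormedModule) _ (fun n => Cmod (a n))); [|exact H].
intros n. change (Rabs (Rabs (Im (a n))) <= Cmod (a n)).
rewrite Rabs_Rabsolu. apply im_le_Cmod.
Qed.

Lemma CSeries_correct (a : nat -> C) : abs_summable a -> is_series a (CSeries a).
Proof.
intros H. apply is_series_C_components. split; apply Series_correct, ex_series_Rabs.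
- now apply abs_summable_Re.
- now apply abs_summable_Im.
Qed.

(** The factor 2 comes from bounding the real and the imaginary part separately;
    it is harmless, as only the order of magnitude matters below. *)
Lemma Cmod_CSeries_le (a : nat -> C) (m : nat -> R) :
  (forall n, Cmod (a n) <= m n) -> ex_series m -> Cmod (CSeries a) <= 2 * Series m.
Proof.
intros H Hm. assert (Ha := abs_summable_le _ _ H Hm).
apply Rle_trans with (1 := Cmod_le_Re_Im _). simpl.
assert (H1 : Rabs (Series (fun n => Re (a n))) <= Series m).
{ apply Rle_trans with (1 := Series_Rabs _ (abs_summable_Re _ Ha)).
  apply Series_le; [|exact Hm]. intros n; split; [apply Rabs_pos|].
  apply Rle_trans with (2 := H n). apply re_le_Cmod. }
assert (H2 : Rabs (Series (fun n => Im (a n))) <= Series m).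
{ apply Rle_trans with (1 := Series_Rabs _ (abs_summable_Im _ Ha)).
  apply Series_le; [|exact Hm]. intros n; split; [apply Rabs_pos|].
  apply Rle_trans with (2 := H n). apply im_le_Cmod. }
lra.
Qed.

(** Dominated convergence for series: up to index k the sums converge termwise,
    and past k both tails are at most the tail of the dominating series. *)
Lemma tannery (u : nat -> nat -> R) (l m : nat -> R) :
  ex_series m -> (forall N i, Rabs (u N i) <= m i) ->
  (forall i, is_lim_seq (fun N => u N i) (l i)) ->
  is_lim_seq (fun N => Series (u N)) (Series l).
Proof.
intros Hm Hu Hl.
assert (Hlm : forall i, Rabs (l i) <= m i).
{ intros i.
  apply (is_lim_seq_le (fun N => Rabs (u N i)) (fun _ => m i) (Rabs (l i)) (m i)).
  - intros N; apply Hu.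
  - now apply (is_lim_seq_abs _ (l i)).
  - apply is_lim_seq_const. }
assert (sU : forall N, ex_series (u N)).
{ intros N. apply (ex_series_le (K := R_AbsRing) (V := R_CompleteNormedModule) _ m); [|exact Hm]. intros i; apply Hu. }
assert (sL : ex_series l).
{ apply (ex_series_le (K := R_AbsRing) (V := R_CompleteNormedModule) _ m); [|exact Hm]. intros i; apply Hlm. }
apply is_lim_seq_spec. intros eps.
assert (Hm' : is_lim_seq (sum_n m) (Series m)) by exact (Series_correct _ Hm).
apply is_lim_seq_spec in Hm'.
(* Both tails are charged to the dominating one, hence a quarter of eps. *)
destruct (Hm' (pos_div_2 (pos_div_2 eps))) as [k Hk].
specialize (Hk k (le_n k)). cbv beta in Hk. simpl in Hk.
assert (Hfin : is_lim_seq (fun N => sum_n (u N) k) (sum_n l k)).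
{ clear Hk. induction k as [|k IH].
  - rewrite sum_O. apply (is_lim_seq_ext (fun N => u N 0%nat)); [|apply Hl].
    intros n; now rewrite sum_O.
  - rewrite sum_Sn.
    apply (is_lim_seq_ext (fun N => sum_n (u N) k + u N (S k)));
      [intros n; now rewrite sum_Sn|].
    apply (is_lim_seq_plus' _ _ (sum_n l k) (l (S k)) IH (Hl (S k))). }
apply is_lim_seq_spec in Hfin.
destruct (Hfin (pos_div_2 eps)) as [N0 HN0].
exists N0. intros N HN. specialize (HN0 N HN). cbv beta in HN0. simpl in HN0.
assert (tail : forall v, ex_series v -> Series v = sum_n v k + Series (fun i => v (S k + i)%nat)).
{ intros v Hv. rewrite (Series_incr_n v (S k)); [|lia|exact Hv].
  rewrite sum_n_Reals. reflexivity. }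
rewrite (tail _ (sU N)), (tail _ sL).
rewrite (tail _ Hm) in Hk.
assert (Hm2 := proj1 (ex_series_incr_n m (S k)) Hm).
assert (tb : forall v, (forall i, Rabs (v i) <= m i) ->
   Rabs (Series (fun i => v (S k + i)%nat)) <= Series (fun i => m (S k + i)%nat)).
{ intros v Hv.
  apply Rle_trans with (Series (fun i => Rabs (v (S k + i)%nat))).
  - apply Series_Rabs.
    apply (ex_series_le (K := R_AbsRing) (V := R_CompleteNormedModule) _ (fun i => m (S k + i)%nat)); [|exact Hm2].
    intros i. change (Rabs (Rabs (v (S k + i)%nat)) <= m (S k + i)%nat).
    rewrite Rabs_Rabsolu. apply Hv.
  - apply Series_le; [|exact Hm2]. intros i; split; [apply Rabs_pos|apply Hv]. }
assert (t1 := tb _ (Hu N)). assert (t2 := tb _ Hlm).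
apply Rabs_le_between in t1, t2.
apply Rabs_lt_between in Hk, HN0. apply Rabs_lt_between.
assert (bound : forall a b c t v w e : R, - (e / 2 / 2) < a - (a + t) < e / 2 / 2 ->
  - (e / 2) < b - c < e / 2 -> - t <= v <= t -> - t <= w <= t ->
  - e < b + v - (c + w) < e) by (intros; lra).
exact (bound _ _ _ _ _ _ _ Hk HN0 t1 t2).
Qed.

Lemma tannery_C (u : nat -> nat -> C) (l : nat -> C) (m : nat -> R) :
  ex_series m -> (forall N i, Cmod (u N i) <= m i) ->
  (forall i, filterlim (fun N => u N i) eventually (@locally C_UniformSpace (l i))) ->
  filterlim (fun N => CSeries (u N)) eventually (@locally C_UniformSpace (CSeries l)).
Proof.
intros Hm Hu Hl. apply filterlim_C_components. split; simpl.
- apply (tannery (fun N i => Re (u N i)) (fun i => Re (l i)) m Hm).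
  + intros N i. apply Rle_trans with (2 := Hu N i). apply re_le_Cmod.
  + intros i. apply (proj1 (filterlim_C_components _ _) (Hl i)).
- apply (tannery (fun N i => Im (u N i)) (fun i => Im (l i)) m Hm).
  + intros N i. apply Rle_trans with (2 := Hu N i). apply im_le_Cmod.
  + intros i. apply (proj1 (filterlim_C_components _ _) (Hl i)).
Qed.

(** * The complex exponential *)

Lemma Cexp_plus (z w : C) : Cexp (z + w) = (Cexp z * Cexp w)%C.
Proof.
destruct z as [x y], w as [x' y']. unfold Cexp. simpl.
rewrite exp_plus, cos_plus, sin_plus.
apply injective_projections; simpl; ring.
Qed.

Lemma Cmod_Cexp (z : C) : Cmod (Cexp z) = exp (Re z).
Proof.
unfold Cmod, Cexp. cbn [fst snd].
replace ((exp (Re z) * cos (Im z)) ^ 2 + (exp (Re z) * sin (Im z)) ^ 2) with (Rsqr (exp (Re z))).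
- apply sqrt_Rsqr. left; apply exp_pos.
- transitivity (Rsqr (exp (Re z)) * (Rsqr (sin (Im z)) + Rsqr (cos (Im z)))).
  + rewrite sin2_cos2. ring.
  + unfold Rsqr; ring.
Qed.

Lemma Cexp_RtoC (x : R) : Cexp x = RtoC (exp x).
Proof.
unfold Cexp, RtoC. simpl. rewrite cos_0, sin_0. f_equal; ring.
Qed.

Lemma Cexp_0 : Cexp 0 = 1%C.
Proof. now rewrite Cexp_RtoC, exp_0. Qed.

Lemma Cexp_neq_0 (z : C) : Cexp z <> 0%C.
Proof. apply Cmod_gt_0. rewrite Cmod_Cexp. apply exp_pos. Qed.

Lemma Cexp_opp (z : C) : Cexp (- z) = (/ Cexp z)%C.
Proof.
assert (Hz := Cexp_neq_0 z).
assert (H : (Cexp (- z) * Cexp z = 1)%C).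
{ rewrite <- Cexp_plus, <- Cexp_0. f_equal. ring. }
transitivity (Cexp (- z) * Cexp z * / Cexp z)%C.
- now field.
- rewrite H. now field.
Qed.

Lemma exp_le_mono (x y : R) : x <= y -> exp x <= exp y.
Proof. intros [H| ->]; [left; now apply exp_increasing | apply Rle_refl]. Qed.

(** Repeated use of this form of the mean value inequality produces all the
    Taylor bounds below, each from the bound of one order less on the derivative. *)
Lemma MVT_abs_bound (f df : R -> R) (x M : R) :
  (forall t, is_derive f t (df t)) -> (forall t, Rabs t <= Rabs x -> Rabs (df t) <= M) ->
  Rabs (f x - f 0) <= M * Rabs x.
Proof.
intros Hd Hb.
destruct (MVT_gen f 0 x df) as [c [Hc Heq]].
- intros; apply Hd.
- intros t _. apply continuity_pt_filterlim.
  apply (ex_derive_continuous (K := R_AbsRing) (V := R_NormedModule) f).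
  exists (df t); apply Hd.
- rewrite Heq, Rabs_mult, Rminus_0_r. apply Rmult_le_compat_r; [apply Rabs_pos|].
  apply Hb. revert Hc. unfold Rmin, Rmax, Rabs.
  destruct (Rle_dec 0 x), (Rcase_abs c), (Rcase_abs x); lra.
Qed.

Lemma Rabs_exp_sub_1 (x : R) : Rabs (exp x - 1) <= exp (Rabs x) * Rabs x.
Proof.
rewrite <- exp_0 at 1. apply (MVT_abs_bound exp exp).
- intros t. auto_derive; [trivial|ring].
- intros t Ht. rewrite Rabs_pos_eq by (left; apply exp_pos).
  apply exp_le_mono. apply Rle_trans with (2 := Ht). apply Rle_abs.
Qed.

Lemma Rabs_exp_sub_1_sub (x : R) : Rabs (exp x - 1 - x) <= exp (Rabs x) * Rabs x * Rabs x.
Proof.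
replace (exp x - 1 - x) with ((exp x - x) - (exp 0 - 0)) by (rewrite exp_0; ring).
apply (MVT_abs_bound (fun t => exp t - t) (fun t => exp t - 1)).
- intros t. auto_derive; [trivial|ring].
- intros t Ht. apply Rle_trans with (1 := Rabs_exp_sub_1 t).
  apply Rmult_le_compat; trivial using Rabs_pos.
  + left; apply exp_pos.
  + now apply exp_le_mono.
Qed.

Lemma Rabs_cos_sub_1 (x : R) : Rabs (cos x - 1) <= Rabs x.
Proof.
rewrite <- cos_0 at 1. rewrite <- (Rmult_1_l (Rabs x)).
apply (MVT_abs_bound cos (fun t => - sin t)).
- intros t. auto_derive; [trivial|ring].
- intros t _. apply Rabs_le. generalize (SIN_bound t); lra.
Qed.

Lemma Rabs_sin_sub (x : R) : Rabs (sin x - x) <= Rabs x * Rabs x.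
Proof.
replace (sin x - x) with ((sin x - x) - (sin 0 - 0)) by (rewrite sin_0; ring).
apply (MVT_abs_bound (fun t => sin t - t) (fun t => cos t - 1)).
- intros t. auto_derive; [trivial|ring].
- intros t Ht. now apply Rle_trans with (1 := Rabs_cos_sub_1 t).
Qed.

Lemma Rabs_cos_sub_1_sq (x : R) : Rabs (cos x - 1) <= Rabs x * Rabs x.
Proof.
rewrite <- cos_0 at 1. apply (MVT_abs_bound cos (fun t => - sin t)).
- intros t. auto_derive; [trivial|ring].
- intros t Ht. apply Rle_trans with (2 := Ht). rewrite Rabs_Ropp.
  replace (sin t) with (sin t - sin 0) by (rewrite sin_0; ring).
  rewrite <- (Rmult_1_l (Rabs t)). apply (MVT_abs_bound sin cos).
  + intros u. auto_derive; [trivial|ring].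
  + intros u _. apply Rabs_le. generalize (COS_bound u); lra.
Qed.

(** With w = x + i y, the real part of e^w - 1 - w is
    e^x (cos y - 1) + (e^x - 1 - x) and the imaginary part is
    e^x (sin y - y) + (e^x - 1) y; each of the four terms is at most
    e^|w| |w|^2. *)
Lemma Cmod_Cexp_sub (w : C) :
  Cmod (Cexp w - 1 - w) <= 4 * (exp (Cmod w) * Cmod w ^ 2).
Proof.
assert (Hx := re_le_Cmod w). assert (Hy := im_le_Cmod w).
set (r := Cmod w) in *.
destruct w as [x y]. simpl in Hx, Hy.
assert (Hr : 0 <= r) by (apply Rle_trans with (2 := Hx); apply Rabs_pos).
assert (He := exp_pos r). assert (He1 : 1 <= exp r) by (rewrite <- exp_0; now apply exp_le_mono).
assert (Hex : exp x <= exp r).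
{ apply exp_le_mono. apply Rle_trans with (2 := Hx). apply Rle_abs. }
assert (Hax : exp (Rabs x) <= exp r) by now apply exp_le_mono.
apply Rle_trans with (1 := Cmod_le_Re_Im _).
assert (px := Rabs_pos x). assert (py := Rabs_pos y). assert (pe := exp_pos x).
assert (pax := exp_pos (Rabs x)).
assert (HR : Rabs (Re (Cexp (x, y) - 1 - (x, y))%C) <= 2 * (exp r * r ^ 2)).
{ replace (Re (Cexp (x, y) - 1 - (x, y))%C)
    with (exp x * (cos y - 1) + (exp x - 1 - x)) by (simpl; ring).
  apply Rle_trans with (1 := Rabs_triang _ _).
  rewrite Rabs_mult, (Rabs_pos_eq (exp x)) by lra.
  assert (h1 := Rabs_cos_sub_1_sq y). assert (h2 := Rabs_exp_sub_1_sub x).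
  assert (h3 : exp x * Rabs (cos y - 1) <= exp r * r ^ 2).
  { apply Rmult_le_compat; try lra; [apply Rabs_pos|nra]. }
  assert (h4 : exp (Rabs x) * Rabs x * Rabs x <= exp r * r ^ 2).
  { rewrite Rmult_assoc. apply Rmult_le_compat; try lra; nra. }
  lra. }
assert (HI : Rabs (Im (Cexp (x, y) - 1 - (x, y))%C) <= 2 * (exp r * r ^ 2)).
{ replace (Im (Cexp (x, y) - 1 - (x, y))%C)
    with (exp x * (sin y - y) + (exp x - 1) * y) by (simpl; ring).
  apply Rle_trans with (1 := Rabs_triang _ _).
  rewrite !Rabs_mult, (Rabs_pos_eq (exp x)) by lra.
  assert (h1 := Rabs_sin_sub y). assert (h2 := Rabs_exp_sub_1 x).
  assert (h3 : exp x * Rabs (sin y - y) <= exp r * r ^ 2).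
  { apply Rmult_le_compat; try lra; [apply Rabs_pos|nra]. }
  assert (h4 : Rabs (exp x - 1) * Rabs y <= exp r * r ^ 2).
  { replace (exp r * r ^ 2) with ((exp r * r) * r) by ring.
    apply Rmult_le_compat; trivial using Rabs_pos.
    apply Rle_trans with (1 := h2). apply Rmult_le_compat; lra. }
  lra. }
lra.
Qed.

(** * Principal powers *)

(** The power n^(-s), written so that it is visibly an exponential in s. *)
Definition npow (s : C) (n : nat) : C := Cexp (- (s * RtoC (ln (INR n)))).

Lemma Clog_pos (x : R) : 0 < x -> Clog x = RtoC (ln x).
Proof.
intros Hx. unfold Clog, Carg. rewrite Cmod_R, Rabs_pos_eq by lra. simpl.
destruct (Rle_dec 0 0) as [_|n]; [|lra].
replace (x / x) with 1 by (field; lra). now rewrite acos_1.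
Qed.

Lemma inv_Cpower_INR (n : nat) (s : C) : (0 < n)%nat -> (/ Cpower (INR n) s)%C = npow s n.
Proof.
intros Hn. unfold Cpower, npow. rewrite Clog_pos by (apply lt_0_INR, Hn).
now rewrite Cexp_opp.
Qed.

Lemma npow_mult (s : C) (m n : nat) :
  (0 < m)%nat -> (0 < n)%nat -> npow s (m * n) = (npow s m * npow s n)%C.
Proof.
intros Hm Hn. unfold npow. rewrite <- Cexp_plus, mult_INR.
rewrite ln_mult by (now apply lt_0_INR). rewrite RtoC_plus. f_equal. ring.
Qed.

Lemma npow_1 (s : C) : npow s 1 = 1%C.
Proof. unfold npow. simpl. rewrite ln_1. rewrite <- Cexp_0. f_equal. ring. Qed.

Lemma Cmod_npow (s : C) (n : nat) : Cmod (npow s n) = exp (- (Re s * ln (INR n))).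
Proof. unfold npow. rewrite Cmod_Cexp. f_equal. destruct s; simpl. ring. Qed.

Lemma Clog_neg (x : R) : 0 < x -> Clog (- x)%R = (ln x, PI).
Proof.
intros Hx. unfold Clog, Carg. rewrite Cmod_R, Rabs_left by lra. simpl.
destruct (Rle_dec 0 0) as [_|n]; [|lra].
replace (- x / - - x) with (- (1)) by (field; lra).
rewrite acos_opp, acos_1, Ropp_involutive, Rminus_0_r. reflexivity.
Qed.

(** The principal logarithm of -x has exponential -x, so at integer exponents
    the choice of the branch has no effect. *)
Lemma Cpower_neg_INR (x : R) (n : nat) : 0 < x ->
  Cpower (- x)%R (- RtoC (INR n)) = RtoC (/ (- x) ^ n).
Proof.
intros Hx. unfold Cpower. rewrite Clog_neg by exact Hx.
assert (H1 : Cexp (- (ln x, PI)) = RtoC (/ - x)).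
{ rewrite Cexp_opp, RtoC_inv by lra. f_equal.
  unfold Cexp. simpl. rewrite cos_PI, sin_PI, exp_ln by exact Hx.
  unfold RtoC. f_equal; ring. }
induction n as [|n IH].
- simpl. replace (- RtoC 0 * (ln x, PI))%C with (RtoC 0) by ring.
  rewrite Cexp_0. f_equal. field.
- replace (- RtoC (INR (S n)) * (ln x, PI))%C
    with (- RtoC (INR n) * (ln x, PI) + - (ln x, PI))%C.
  + rewrite Cexp_plus, IH, H1, <- RtoC_mult. f_equal. simpl.
    field. split; [apply pow_nonzero; lra|lra].
  + rewrite S_INR, RtoC_plus. ring.
Qed.

(** * The Fejer kernel at rational frequencies *)

Lemma Ccos_RtoC (x : R) : Ccos x = RtoC (cos x).
Proof.
unfold Ccos, Cexp.
replace (Re (Ci * x)%C) with 0 by (simpl; ring).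
replace (Im (Ci * x)%C) with x by (simpl; ring).
replace (Re (- (Ci * x))%C) with 0 by (simpl; ring).
replace (Im (- (Ci * x))%C) with (- x) by (simpl; ring).
rewrite exp_0, cos_neg, sin_neg.
replace (Cplus (1 * cos x, 1 * sin x) (1 * cos x, 1 * - sin x)) with (RtoC (2 * cos x)).
- rewrite <- RtoC_div by lra. f_equal. field.
- apply injective_projections; simpl; ring.
Qed.

Lemma RtoC_sum_n_m (f : nat -> R) (n m : nat) :
  RtoC (sum_n_m f n m) = sum_n_m (fun k => RtoC (f k)) n m.
Proof.
destruct (Nat.lt_ge_cases m n) as [H|H].
- now rewrite !sum_n_m_zero.
- induction H as [|m H IH].
  + now rewrite !sum_n_n.
  + rewrite !sum_n_Sm, <- IH by lia. apply RtoC_plus.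
Qed.

(** The sum of F(n, i) at the angle theta = 2 PI n / i, cut at j so that closed
    forms can be proved by induction on j. *)
Definition fejer_sum (i : nat) (theta : R) (j : nat) : R :=
  sum_n_m (fun k => INR (i - k) * cos (INR k * theta)) 1 j.

Lemma F_INR (n i : nat) : (0 < i)%nat ->
  F (INR n) i = RtoC (INR i + 2 * fejer_sum i (2 * PI * INR n / INR i) (i - 1)).
Proof.
intros Hi. assert (Hi' : INR i <> 0) by (apply not_0_INR; lia).
unfold F, fejer_sum. rewrite RtoC_plus, RtoC_mult. do 2 f_equal.
rewrite RtoC_sum_n_m. apply sum_n_m_ext. intros k.
rewrite RtoC_mult. f_equal.
rewrite <- Ccos_RtoC. f_equal.
replace (INR k * (2 * PI * INR n / INR i)) with (2 * PI * INR k * INR n / INR i) by (field; trivial).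
rewrite !RtoC_div, !RtoC_mult by trivial. reflexivity.
Qed.

Lemma fejer_sum_S (i j : nat) (theta : R) :
  fejer_sum i theta (S j) = fejer_sum i theta j + INR (i - S j) * cos (INR (S j) * theta).
Proof. unfold fejer_sum. rewrite sum_n_Sm by lia. reflexivity. Qed.

Lemma fejer_sum_0 (i : nat) (theta : R) : fejer_sum i theta 0 = 0.
Proof. unfold fejer_sum. now rewrite sum_n_m_zero by lia. Qed.

(** Summation by parts: multiplying cos (k theta) by 2 - 2 cos theta takes its
    second difference in k, and the weights i - k are affine in k, so only
    boundary terms remain. *)
Lemma fejer_sum_closed (i j : nat) (theta : R) : (j < i)%nat ->
  (2 - 2 * cos theta) * fejer_sum i theta j =
  - (INR i - 1) + INR i * cos theta
  + (INR i - INR j - 1) * cos (INR j * theta)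
  - (INR i - INR j) * cos (INR (S j) * theta).
Proof.
induction j as [|j IH]; intros Hj.
- rewrite fejer_sum_0. simpl. rewrite Rmult_0_l, cos_0, Rmult_1_l. ring.
- rewrite fejer_sum_S, Rmult_plus_distr_l, IH by lia.
  rewrite (minus_INR i (S j)) by lia.
  assert (H : cos (INR (S (S j)) * theta) + cos (INR j * theta)
              = 2 * cos theta * cos (INR (S j) * theta)).
  { replace (INR (S (S j)) * theta) with (INR (S j) * theta + theta) by (rewrite (S_INR (S j)); ring).
    replace (INR j * theta) with (INR (S j) * theta - theta) by (rewrite (S_INR j); ring).
    rewrite cos_plus, cos_minus. ring. }
  replace (cos (INR (S (S j)) * theta)) with
    (2 * cos theta * cos (INR (S j) * theta) - cos (INR j * theta)) by lra.
  rewrite (S_INR j). ring.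
Qed.

Lemma fejer_sum_cos_1 (i j : nat) (theta : R) : (j < i)%nat ->
  (forall k : nat, cos (INR k * theta) = 1) ->
  2 * fejer_sum i theta j = INR j * (2 * INR i - INR j - 1).
Proof.
intros Hj Hc. induction j as [|j IH].
- rewrite fejer_sum_0. simpl. ring.
- rewrite fejer_sum_S, Hc, Rmult_plus_distr_l, IH by lia.
  rewrite minus_INR by lia. rewrite (S_INR j). ring.
Qed.

Lemma cos_INR_2PI (x : R) (k : nat) : x = 2 * PI * INR k -> cos x = 1.
Proof.
intros ->. replace (2 * PI * INR k) with (0 + 2 * INR k * PI) by ring.
now rewrite cos_period, cos_0.
Qed.

Lemma F_INR_divide (n i : nat) : (0 < i)%nat -> Nat.divide i n -> F (INR n) i = RtoC (INR i ^ 2).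
Proof.
intros Hi [m ->]. assert (Hi' : INR i <> 0) by (apply not_0_INR; lia).
rewrite F_INR by exact Hi. f_equal.
rewrite fejer_sum_cos_1; [|lia|].
- rewrite minus_INR by lia. simpl. ring.
- intros k. apply (cos_INR_2PI _ (k * m)). rewrite !mult_INR. now field.
Qed.

(** At j = i - 1 the closed form reads
    (1 - cos theta) (i + 2 fejer_sum) = 0, because i theta is a multiple of 2 PI;
    and cos theta < 1 because n / i is not an integer. *)
Lemma F_INR_not_divide (n i : nat) : (0 < i)%nat -> ~ Nat.divide i n -> F (INR n) i = RtoC 0.
Proof.
intros Hi Hn. assert (Hi' : 0 < INR i) by (apply lt_0_INR; lia).
rewrite F_INR by exact Hi. f_equal.
set (theta := 2 * PI * INR n / INR i).
assert (Hc : cos theta < 1).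
{ assert (Hd := Nat.div_mod n i ltac:(lia)).
  assert (Hr : (0 < n mod i)%nat).
  { destruct (Nat.eq_0_gt_0_cases (n mod i)) as [H0|H0]; [|exact H0].
    exfalso. apply Hn. now apply Nat.Lcm0.mod_divide. }
  assert (Hr' := Nat.mod_upper_bound n i ltac:(lia)).
  apply lt_0_INR in Hr. apply lt_INR in Hr'.
  replace theta with (2 * (PI * INR (n mod i) / INR i) + 2 * INR (n / i) * PI).
  - rewrite cos_period, cos_2a_sin.
    assert (0 < sin (PI * INR (n mod i) / INR i)).
    { assert (HP := PI_RGT_0). apply sin_gt_0.
      - apply Rdiv_lt_0_compat; [nra|lra].
      - apply Rmult_lt_reg_r with (INR i); [exact Hi'|].
        replace (PI * INR (n mod i) / INR i * INR i) with (PI * INR (n mod i)) by (field; lra).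
        nra. }
    nra.
  - unfold theta. rewrite Hd at 3. rewrite plus_INR, mult_INR. field. lra. }
assert (H := fejer_sum_closed i (i - 1) theta ltac:(lia)).
replace (S (i - 1)) with i in H by lia.
rewrite (cos_INR_2PI (INR i * theta) n) in H by (unfold theta; field; lra).
rewrite minus_INR in H by lia. change (INR 1) with 1 in H.
assert (H2 : (1 - cos theta) * (INR i + 2 * fejer_sum i theta (i - 1)) = 0) by lra.
apply Rmult_integral in H2. destruct H2 as [H2|H2]; [lra|exact H2].
Qed.

(** * The Dirichlet series of zeta and its growth at 1 *)

Lemma ex_series_le_R (a m : nat -> R) :
  (forall n, 0 <= a n <= m n) -> ex_series m -> ex_series a.
Proof.
intros H Hm.
apply (ex_series_le (K := R_AbsRing) (V := R_CompleteNormedModule) _ m); [|exact Hm].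
intros n. change (Rabs (a n) <= m n). rewrite Rabs_pos_eq; apply H.
Qed.

Lemma ln_INR_nonneg (n : nat) : (0 < n)%nat -> 0 <= ln (INR n).
Proof.
intros Hn. rewrite <- ln_1. apply ln_le; [lra|]. apply (le_INR 1). lia.
Qed.

(** The bounds 1/(n+1) <= ln (n+1) - ln n <= 1/n, with the reciprocals written as
    exponentials to fit products of powers. *)
Lemma ln_INR_step (n : nat) : (0 < n)%nat ->
  exp (- ln (INR (S n))) <= ln (INR (S n)) - ln (INR n) <= exp (- ln (INR n)).
Proof.
intros Hn. assert (H0 : 0 < INR n) by now apply lt_0_INR.
assert (H1 : INR (S n) = INR n + 1) by apply S_INR.
rewrite !exp_Ropp, !exp_ln by lra. split.
- assert (H := exp_ineq1_le (ln (INR n) - ln (INR (S n)))).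
  unfold Rminus in H. rewrite exp_plus, exp_Ropp, !exp_ln in H by lra.
  replace (INR n * / INR (S n)) with (1 - / INR (S n)) in H by (rewrite H1; field; lra).
  lra.
- assert (H := exp_ineq1_le (ln (INR (S n)) - ln (INR n))).
  unfold Rminus in H. rewrite exp_plus, exp_Ropp, !exp_ln in H by lra.
  replace (INR (S n) * / INR n) with (1 + / INR n) in H by (rewrite H1; field; lra).
  lra.
Qed.

(** The increments of n^(-t) compare with t n^(-1-t) on both sides: one side gives
    the convergence of the series of n^(-1-t), the other the lower bound 1/t. *)
Lemma power_telescope (t : R) (n : nat) : 0 <= t -> (0 < n)%nat ->
  t * exp (- ((1 + t) * ln (INR (S n)))) <=
  exp (- (t * ln (INR n))) - exp (- (t * ln (INR (S n)))) <=
  t * exp (- ((1 + t) * ln (INR n))).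
Proof.
intros Ht Hn. destruct (ln_INR_step n Hn) as [h1 h2].
set (x := ln (INR n)) in *. set (y := ln (INR (S n))) in *.
replace (- ((1 + t) * y)) with (- y + - (t * y)) by ring.
replace (- ((1 + t) * x)) with (- x + - (t * x)) by ring.
rewrite !exp_plus.
assert (px := exp_pos (- (t * x))). assert (py := exp_pos (- (t * y))). split.
- replace (exp (- (t * x))) with (exp (t * (y - x)) * exp (- (t * y)))
    by (rewrite <- exp_plus; f_equal; ring).
  assert (H := exp_ineq1_le (t * (y - x))).
  assert (t * exp (- y) <= exp (t * (y - x)) - 1) by nra. nra.
- replace (exp (- (t * y))) with (exp (- (t * (y - x))) * exp (- (t * x)))
    by (rewrite <- exp_plus; f_equal; ring).
  assert (H := exp_ineq1_le (- (t * (y - x)))).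
  assert (1 - exp (- (t * (y - x))) <= t * exp (- x)) by nra. nra.
Qed.

Lemma is_lim_seq_power (t : R) : 0 < t ->
  is_lim_seq (fun n => exp (- (t * ln (INR (n + 1))))) 0.
Proof.
intros Ht. apply is_lim_seq_spec. intros eps. assert (He := cond_pos eps).
(* n^(-t) < eps as soon as ln n > - ln eps / t. *)
destruct (nfloor_ex (exp (- ln eps / t)) (Rlt_le _ _ (exp_pos _))) as [N [_ HN]].
exists N. intros n Hn. rewrite Rminus_0_r, Rabs_pos_eq by (left; apply exp_pos).
rewrite <- (exp_ln eps) by exact He. apply exp_increasing.
assert (H : - ln eps / t < ln (INR (n + 1))).
{ rewrite <- (ln_exp (- ln eps / t)). apply ln_increasing; [apply exp_pos|].
  apply Rlt_le_trans with (1 := HN). rewrite plus_INR. apply le_INR in Hn. simpl. lra. }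
apply (Rmult_lt_compat_l t) in H; [|exact Ht].
replace (t * (- ln eps / t)) with (- ln eps) in H by (field; lra). lra.
Qed.

Lemma is_series_power_telescope (t : R) : 0 < t ->
  is_series (fun n => exp (- (t * ln (INR (n + 1)))) - exp (- (t * ln (INR (S (n + 1)))))) 1.
Proof.
intros Ht.
apply (is_lim_seq_ext (fun n => 1 - exp (- (t * ln (INR (S n + 1))))) _ 1).
- intros n. induction n as [|n IH].
  + rewrite sum_O. simpl (0 + 1)%nat. change (INR 1) with 1. rewrite ln_1, Rmult_0_r, Ropp_0, exp_0.
    reflexivity.
  + rewrite sum_Sn, <- IH. change plus with Rplus. cbv beta.
    change (S (S n + 1)) with (S (S n) + 1)%nat. ring.
- replace (Finite 1) with (Finite (1 - 0)) by (f_equal; ring).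
  apply is_lim_seq_minus'; [apply is_lim_seq_const|].
  apply (is_lim_seq_incr_1 (fun n => exp (- (t * ln (INR (n + 1)))))).
  now apply is_lim_seq_power.
Qed.

Lemma ex_series_power (sigma : R) : 1 < sigma ->
  ex_series (fun n => exp (- (sigma * ln (INR (n + 1))))).
Proof.
intros Hs. apply ex_series_incr_1.
apply ex_series_le_R with (fun n => / (sigma - 1) *
  (exp (- ((sigma - 1) * ln (INR (n + 1)))) - exp (- ((sigma - 1) * ln (INR (S (n + 1))))))).
- intros n. split; [left; apply exp_pos|].
  assert (H := proj1 (power_telescope (sigma - 1) (n + 1) ltac:(lra) ltac:(lia))).
  replace (1 + (sigma - 1)) with sigma in H by ring.
  apply Rmult_le_reg_l with (sigma - 1); [lra|].
  rewrite <- Rmult_assoc, Rinv_r, Rmult_1_l by lra. exact H.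
- apply (ex_series_scal (V := R_NormedModule)).
  exists 1. apply is_series_power_telescope. lra.
Qed.

Lemma Series_power_ge (t : R) : 0 < t ->
  / t <= Series (fun n => exp (- ((1 + t) * ln (INR (n + 1))))).
Proof.
intros Ht. apply Rmult_le_reg_l with t; [exact Ht|].
rewrite Rinv_r, <- Series_scal_l by lra.
rewrite <- (is_series_unique _ _ (is_series_power_telescope t Ht)) at 1.
apply Series_le.
- intros n. split.
  + destruct (power_telescope t (n + 1) ltac:(lra) ltac:(lia)) as [H _].
    apply Rle_trans with (2 := H). apply Rmult_le_pos; [lra|]. left; apply exp_pos.
  + apply (power_telescope t (n + 1)); [lra|lia].
- apply (ex_series_scal (V := R_NormedModule)). apply ex_series_power. lra.
Qed.

Lemma npow_summable (s : C) : 1 < Re s -> abs_summable (fun n => npow s (n + 1)).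
Proof.
intros Hs. apply abs_summable_le with (2 := ex_series_power (Re s) Hs).
intros n. rewrite Cmod_npow. apply Rle_refl.
Qed.

Lemma zeta_npow (s : C) : zeta s = CSeries (fun n => npow s (n + 1)).
Proof.
unfold zeta. apply CSeries_ext. intros n.
rewrite <- inv_Cpower_INR by lia. unfold Cdiv. apply Cmult_1_l.
Qed.

Definition zeta_sum (s : C) (k : nat) : C := sum_n_m (npow s) 1 k.

Lemma zeta_sum_S (s : C) (k : nat) : zeta_sum s (S k) = (zeta_sum s k + npow s (S k))%C.
Proof. unfold zeta_sum. rewrite sum_n_Sm by lia. reflexivity. Qed.

Lemma zeta_sum_0 (s : C) : zeta_sum s 0 = 0%C.
Proof. unfold zeta_sum. now rewrite sum_n_m_zero by lia. Qed.

Lemma zeta_sum_sum_n (s : C) (k : nat) :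
  zeta_sum s (S k) = sum_n (fun n => npow s (n + 1)) k.
Proof.
induction k as [|k IH].
- rewrite sum_O, zeta_sum_S, zeta_sum_0. apply Cplus_0_l.
- rewrite sum_Sn, <- IH, zeta_sum_S. now replace (S k + 1)%nat with (S (S k)) by lia.
Qed.

Lemma zeta_sum_lim (s : C) : 1 < Re s ->
  filterlim (zeta_sum s) eventually (@locally C_UniformSpace (zeta s)).
Proof.
intros Hs. rewrite zeta_npow. apply filterlim_C_components.
assert (H := CSeries_correct _ (npow_summable s Hs)).
assert (H' : is_lim_seq (fun n => Re (sum_n (fun n => npow s (n + 1)) n)) (Re (CSeries (fun n : nat => npow s (n + 1))))
 /\ is_lim_seq (fun n => Im (sum_n (fun n => npow s (n + 1)) n)) (Im (CSeries (fun n : nat => npow s (n + 1))))) by now apply filterlim_C_components.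
destruct H' as [H1 H2].
split; apply is_lim_seq_incr_1.
- apply (is_lim_seq_ext _ _ _ (fun n => eq_sym (f_equal Re (zeta_sum_sum_n s n))) H1).
- apply (is_lim_seq_ext _ _ _ (fun n => eq_sym (f_equal Im (zeta_sum_sum_n s n))) H2).
Qed.

Lemma zeta_sum_bound (s : C) (k : nat) : 1 < Re s ->
  Cmod (zeta_sum s k) <= Series (fun n => Cmod (npow s (n + 1))).
Proof.
intros Hs. assert (H := npow_summable s Hs).
assert (Hle : forall j, sum_n (fun n => Cmod (npow s (n + 1))) j <= Series (fun n => Cmod (npow s (n + 1)))).
{ apply is_lim_seq_incr_compare.
  - exact (Series_correct _ H).
  - intros j. rewrite sum_Sn. change plus with Rplus.
    generalize (Cmod_ge_0 (npow s (S j + 1))). lra. }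
destruct k as [|k].
- rewrite zeta_sum_0, Cmod_0. apply Rle_trans with (2 := Hle 0%nat).
  rewrite sum_O. apply Cmod_ge_0.
- apply Rle_trans with (2 := Hle k). rewrite zeta_sum_sum_n.
  clear. induction k as [|k IH]; [rewrite !sum_O; apply Rle_refl|].
  rewrite !sum_Sn. apply Rle_trans with (1 := Cmod_triangle _ _).
  now apply Rplus_le_compat_r.
Qed.

(** * Dirichlet series of divisor sums *)

Lemma div_S (m d : nat) : (0 < d)%nat ->
  (S m / d = m / d + if Nat.eq_dec (S m mod d) 0 then 1 else 0)%nat.
Proof.
intros Hd. assert (H1 := Nat.div_mod m d ltac:(lia)).
assert (H2 := Nat.mod_upper_bound m d ltac:(lia)).
destruct (Nat.eq_dec (S (m mod d)) d) as [He|He].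
- assert (Hq : S m = (d * (m / d + 1) + 0)%nat) by nia.
  rewrite <- (Nat.mod_unique _ _ _ _ Hd Hq).
  rewrite <- (Nat.div_unique _ _ _ _ Hd Hq).
  destruct (Nat.eq_dec 0 0); lia.
- assert (Hr : (S (m mod d) < d)%nat) by lia.
  assert (Hq : S m = (d * (m / d) + S (m mod d))%nat) by nia.
  rewrite <- (Nat.mod_unique _ _ _ _ Hr Hq).
  rewrite <- (Nat.div_unique _ _ _ _ Hr Hq).
  destruct (Nat.eq_dec (S (m mod d)) 0); lia.
Qed.

Definition on_multiples (d n : nat) (a : C) : C :=
  if Nat.eq_dec (n mod d) 0 then a else 0%C.

(** The multiples of d up to N + 2 are the products d m with m <= (N + 2) / d, and
    n^(-s) is multiplicative.  As d >= 2, nothing is lost by starting at n = 2. *)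
Lemma sum_on_multiples (s : C) (d : nat) (a : C) (N : nat) : (2 <= d)%nat ->
  sum_n (fun n => on_multiples d (n + 2) a * npow s (n + 2))%C N =
  (a * npow s d * zeta_sum s ((N + 2) / d))%C.
Proof.
intros Hd.
assert (step : forall m, (a * npow s d * zeta_sum s (S m / d) =
  a * npow s d * zeta_sum s (m / d) + on_multiples d (S m) a * npow s (S m))%C).
{ intros m. rewrite div_S by lia. unfold on_multiples.
  destruct (Nat.eq_dec (S m mod d) 0) as [H0|H0].
  - assert (Hm := Nat.div_mod (S m) d ltac:(lia)).
    rewrite div_S in Hm by lia. destruct (Nat.eq_dec (S m mod d) 0); [|easy].
    rewrite H0, Nat.add_0_r in Hm. rewrite Hm.
    rewrite npow_mult by lia. rewrite Nat.add_1_r, zeta_sum_S. ring.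
  - rewrite Nat.add_0_r. ring. }
induction N as [|N IH].
- rewrite sum_O. simpl (0 + 2)%nat. rewrite step.
  rewrite (Nat.div_small 1 d) by lia. rewrite zeta_sum_0, Cmult_0_r.
  symmetry. apply Cplus_0_l.
- rewrite sum_Sn, IH. change (S N + 2)%nat with (S (N + 2)). rewrite step. reflexivity.
Qed.

Lemma is_series_sum_n (g : nat -> nat -> C) (l : nat -> C) (N : nat) :
  (forall n, is_series (g n) (l n)) ->
  is_series (fun i => sum_n (fun n => g n i) N) (sum_n l N).
Proof.
intros H. induction N as [|N IH].
- rewrite sum_O. eapply is_series_ext; [|apply (H 0%nat)].
  intros i. now rewrite sum_O.
- rewrite sum_Sn. eapply is_series_ext; [|apply (is_series_plus _ _ _ _ IH (H (S N)))].
  intros i. cbv beta. now rewrite sum_Sn.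
Qed.

Lemma filterlim_div (d : nat) : (0 < d)%nat ->
  filterlim (fun N => ((N + 2) / d)%nat) eventually eventually.
Proof.
intros Hd P [K HK]. exists (d * K)%nat. intros N HN. apply HK.
apply Nat.div_le_lower_bound; lia.
Qed.

Lemma npow_le_1 (s : C) (n : nat) : 0 <= Re s -> (0 < n)%nat -> Cmod (npow s n) <= 1.
Proof.
intros Hs Hn. rewrite Cmod_npow, <- exp_0. apply exp_le_mono.
assert (H := ln_INR_nonneg n Hn). nra.
Qed.

Lemma on_multiples_summable (c : nat -> C) (n : nat) :
  abs_summable (fun i => c (i + 2)%nat) ->
  abs_summable (fun i => on_multiples (i + 2) n (c (i + 2)%nat)).
Proof.
intros H. apply abs_summable_le with (2 := H). intros i. unfold on_multiples.
destruct (Nat.eq_dec (n mod (i + 2)) 0).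
- apply Rle_refl.
- rewrite Cmod_0. apply Cmod_ge_0.
Qed.

(** The partial sums in n, exchanged with the sum over the divisor i, have terms
    c_i i^(-s) times a partial sum of zeta whose length tends to infinity with N;
    [tannery_C] passes to the limit under the sum over i. *)
Lemma divisor_sum_dirichlet (c : nat -> C) (s : C) :
  abs_summable (fun i => c (i + 2)%nat) -> 1 < Re s ->
  is_series
    (fun n => CSeries (fun i => on_multiples (i + 2) (n + 2) (c (i + 2)%nat)) * npow s (n + 2))%C
    (CSeries (fun i => c (i + 2)%nat * npow s (i + 2))%C * zeta s)%C.
Proof.
intros Hc Hs.
set (M := Series (fun n => Cmod (npow s (n + 1)))).
set (u := fun N i => (c (i + 2)%nat * npow s (i + 2) * zeta_sum s ((N + 2) / (i + 2)))%C).
assert (HM : 0 <= M).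
{ apply Rle_trans with (2 := zeta_sum_bound s 0 Hs). apply Cmod_ge_0. }
assert (Hm : forall i, Cmod (c (i + 2)%nat * npow s (i + 2)) <= Cmod (c (i + 2)%nat)).
{ intros i. rewrite Cmod_mult, <- Rmult_1_r. apply Rmult_le_compat_l; [apply Cmod_ge_0|].
  apply npow_le_1; [lra|lia]. }
assert (Hlim : filterlim (fun N => CSeries (u N)) eventually
  (@locally C_UniformSpace (CSeries (fun i => c (i + 2)%nat * npow s (i + 2) * zeta s)%C))).
{ apply tannery_C with (m := fun i => M * Cmod (c (i + 2)%nat)).
  - apply (ex_series_scal (V := R_NormedModule)). exact Hc.
  - intros N i. unfold u. rewrite Cmod_mult, Rmult_comm.
    apply Rmult_le_compat; try apply Cmod_ge_0; [now apply zeta_sum_bound|apply Hm].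
  - intros i. unfold u.
    apply (filterlim_comp _ _ _ (fun N => zeta_sum s ((N + 2) / (i + 2)))
      (fun z => (c (i + 2)%nat * npow s (i + 2) * z)%C) _ (@locally C_UniformSpace (zeta s))).
    + apply (filterlim_comp _ _ _ (fun N => ((N + 2) / (i + 2))%nat) (zeta_sum s) _ eventually).
      * apply filterlim_div. lia.
      * now apply zeta_sum_lim.
    + apply (filterlim_scal_r (K := C_AbsRing) (V := C_NormedModule)). }
rewrite (CSeries_unique (fun i => c (i + 2)%nat * npow s (i + 2) * zeta s)%C
   (CSeries (fun i => c (i + 2)%nat * npow s (i + 2))%C * zeta s)%C) in Hlim.
- unfold is_series. revert Hlim. apply filterlim_ext. intros N.
  apply CSeries_unique.
  eapply is_series_ext; [|apply (is_series_sum_n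
    (fun n i => on_multiples (i + 2) (n + 2) (c (i + 2)%nat) * npow s (n + 2))%C)].
  + intros i. cbv beta. rewrite sum_on_multiples by lia. reflexivity.
  + intros n. rewrite Cmult_comm.
    eapply is_series_ext; [|apply (is_series_scal (K := C_AbsRing) (V := C_NormedModule)
       (npow s (n + 2))), CSeries_correct, on_multiples_summable, Hc].
    intros i. apply Cmult_comm.
- rewrite Cmult_comm.
  eapply is_series_ext; [|apply (is_series_scal (K := C_AbsRing) (V := C_NormedModule)
       (zeta s)), CSeries_correct].
  + intros i. apply Cmult_comm.
  + now apply abs_summable_le with (2 := Hc).
Qed.

(** * Dirichlet series with rapidly decreasing coefficients *)

(** Decay faster than every power of n, which makes the Dirichlet series and all
    its termwise derivatives converge on the whole plane. *)
Definition rapidly_decreasing (c : nat -> C) : Prop :=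
  forall p : R, ex_series (fun n => Cmod (c n) * exp (p * ln (INR (n + 1)))).

Definition dirichlet_series (c : nat -> C) (s : C) : C :=
  CSeries (fun n => c n * npow s (n + 1))%C.

Lemma rapidly_decreasing_summable (c : nat -> C) (s : C) :
  rapidly_decreasing c -> abs_summable (fun n => c n * npow s (n + 1))%C.
Proof.
intros H. apply abs_summable_le with (2 := H (- Re s)). intros n.
rewrite Cmod_mult, Cmod_npow. apply Req_le. do 2 f_equal. ring.
Qed.

(** The increment over h is compared with h times the termwise derivative: by
    [Cmod_Cexp_sub] the error for |h| <= 1 is at most |h|^2 times a convergent
    series, since lam^2 e^(|h| lam) <= e^(3 lam). *)
Lemma ex_derive_dirichlet_series (c : nat -> C) (s : C) :
  rapidly_decreasing c -> ex_derive (K := C_AbsRing) (V := C_NormedModule) (dirichlet_series c) s.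
Proof.
intros Hc.
set (lam := fun n => ln (INR (n + 1))).
set (d := fun n => (- (c n * RtoC (lam n)) * npow s (n + 1))%C).
assert (Hlam : forall n, 0 <= lam n) by (intros n; apply ln_INR_nonneg; lia).
assert (Hlam2 : forall n, lam n <= exp (lam n)).
{ intros n. generalize (exp_ineq1_le (lam n)). lra. }
assert (Hd : abs_summable d).
{ apply abs_summable_le with (2 := Hc (1 - Re s)). intros n. unfold d.
  rewrite Cmod_mult, Cmod_opp, Cmod_mult, Cmod_npow, Cmod_R, (Rabs_pos_eq (lam n)) by apply Hlam.
  fold (lam n). replace ((1 - Re s) * lam n) with (lam n + - (Re s * lam n)) by ring.
  rewrite exp_plus, <- Rmult_assoc.
  apply Rmult_le_compat_r; [left; apply exp_pos|].
  apply Rmult_le_compat_l; [apply Cmod_ge_0|]. apply Hlam2. }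
set (S := Series (fun n => Cmod (c n) * exp ((3 - Re s) * lam n))).
assert (HS : 0 <= S).
{ apply Rle_trans with (Series (fun _ : nat => 0)).
  - rewrite (Series_ext _ (fun n => 0 * 0)) by (intros; ring).
    rewrite Series_scal_l. lra.
  - apply Series_le; [|apply Hc]. intros n. split; [lra|].
    apply Rmult_le_pos; [apply Cmod_ge_0|left; apply exp_pos]. }
assert (key : forall h : C, Cmod h <= 1 ->
  Cmod (dirichlet_series c (s + h) - dirichlet_series c s - h * CSeries d) <= 8 * S * Cmod h ^ 2).
{ intros h Hh.
  assert (H0 := Cmod_ge_0 h).
  assert (E : (dirichlet_series c (s + h) - dirichlet_series c s - h * CSeries d)%C =
    CSeries (fun n => c n * npow s (n + 1) *
      (Cexp (- (h * RtoC (lam n))) - 1 - (- (h * RtoC (lam n)))))%C).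
  { symmetry. apply CSeries_unique.
    assert (H1 := CSeries_correct _ (rapidly_decreasing_summable c (s + h) Hc)).
    assert (H2 := CSeries_correct _ (rapidly_decreasing_summable c s Hc)).
    assert (H3 := is_series_scal h _ _ (CSeries_correct _ Hd)).
    assert (H := is_series_minus _ _ _ _ (is_series_minus _ _ _ _ H1 H2) H3).
    eapply is_series_ext; [|exact H].
    intros n. unfold minus, plus, opp, scal, d. simpl. unfold mult. simpl.
    replace (npow (s + h) (n + 1)) with (npow s (n + 1) * Cexp (- (h * RtoC (lam n))))%C.
    - change (@eq C (c n * (npow s (n + 1) * Cexp (- (h * lam n))) + - (c n * npow s (n + 1)) +
        - (h * (- (c n * lam n) * npow s (n + 1))))%C
        (c n * npow s (n + 1) * (Cexp (- (h * lam n)) - 1 - - (h * lam n)))%C). ring.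
    - unfold npow. rewrite <- Cexp_plus. f_equal. unfold lam. ring. }
  rewrite E.
  apply Rle_trans with (2 * Series (fun n => 4 * Cmod h ^ 2 * (Cmod (c n) * exp ((3 - Re s) * lam n)))).
  2: { rewrite Series_scal_l. fold S. lra. }
  apply Cmod_CSeries_le.
  2: { apply (ex_series_scal (V := R_NormedModule)). apply Hc. }
  intros n. rewrite !Cmod_mult, Cmod_npow. fold (lam n).
  assert (Hb := Cmod_Cexp_sub (- (h * RtoC (lam n)))).
  rewrite Cmod_opp, Cmod_mult, Cmod_R, (Rabs_pos_eq (lam n)) in Hb by apply Hlam.
  assert (Hl := Hlam n). assert (Hl2 := Hlam2 n). assert (Hp := exp_pos (lam n)).
  assert (He : exp (Cmod h * lam n) <= exp (lam n)) by (apply exp_le_mono; nra).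
  assert (Hq : exp (Cmod h * lam n) * (Cmod h * lam n) ^ 2 <= exp (3 * lam n) * Cmod h ^ 2).
  { replace (3 * lam n) with (lam n + (lam n + lam n)) by ring. rewrite !exp_plus.
    replace ((Cmod h * lam n) ^ 2) with ((lam n * lam n) * Cmod h ^ 2) by ring.
    rewrite <- Rmult_assoc. apply Rmult_le_compat_r; [apply pow2_ge_0|].
    apply Rmult_le_compat; trivial; [left; apply exp_pos|nra|].
    now apply Rmult_le_compat. }
  replace ((3 - Re s) * lam n) with (3 * lam n + - (Re s * lam n)) by ring.
  rewrite exp_plus.
  replace (4 * Cmod h ^ 2 * (Cmod (c n) * (exp (3 * lam n) * exp (- (Re s * lam n)))))
    with (Cmod (c n) * exp (- (Re s * lam n)) * (4 * (exp (3 * lam n) * Cmod h ^ 2))) by ring.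
  apply Rmult_le_compat_l.
  - apply Rmult_le_pos; [apply Cmod_ge_0|left; apply exp_pos].
  - lra. }
exists (CSeries d). split; [apply is_linear_scal_l|].
intros x Hx. apply (is_filter_lim_locally_unique (K := C_AbsRing) (V := AbsRing_NormedModule C_AbsRing)) in Hx. subst x.
intros eps. assert (Heps := cond_pos eps).
assert (Hdelta : 0 < Rmin 1 (eps / (8 * S + 1))).
{ apply Rmin_pos; [lra|]. apply Rdiv_lt_0_compat; lra. }
(* The remainder 8 S |h|^2 is at most eps |h| once |h| <= eps / (8 S + 1). *)
exists (mkposreal _ Hdelta). intros y Hy.
change (Cmod (y - s) < Rmin 1 (eps / (8 * S + 1))) in Hy.
change (Cmod (dirichlet_series c y - dirichlet_series c s - (y - s) * CSeries d)
  <= eps * Cmod (y - s)).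
assert (Hy1 := Rlt_le_trans _ _ _ Hy (Rmin_l _ _)).
assert (Hy2 := Rlt_le_trans _ _ _ Hy (Rmin_r _ _)).
replace y with (s + (y - s))%C at 1 by ring.
apply Rle_trans with (1 := key (y - s)%C (Rlt_le _ _ Hy1)).
assert (H0 := Cmod_ge_0 (y - s)).
replace (8 * S * Cmod (y - s) ^ 2) with (8 * S * Cmod (y - s) * Cmod (y - s)) by ring.
apply Rmult_le_compat_r; [exact H0|].
apply Rmult_lt_compat_l with (r := 8 * S + 1) in Hy2; [|lra].
replace ((8 * S + 1) * (eps / (8 * S + 1))) with (pos eps) in Hy2 by (field; lra).
lra.
Qed.

Lemma entire_of_ex_derive (f : C -> C) : (forall s : C, ex_derive f s) -> entire f.
Proof. intros H s. unfold holomorphic_at. apply filter_forall. exact H. Qed.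

(** Half of the geometric decay absorbs the power: as ln n grows slower than any
    multiple of n, p ln n <= (ln Q / 2) n + constant. *)
Lemma ex_series_geom_power (Q p : R) : 1 < Q ->
  ex_series (fun n => / Q ^ (n + 1) * exp (p * ln (INR (n + 1)))).
Proof.
intros HQ.
assert (HL : 0 < ln Q) by (rewrite <- ln_1; apply ln_increasing; lra).
(* P bounds p and is positive; ln x <= eps x - ln eps with eps = delta / P. *)
set (delta := ln Q / 2). set (P := Rabs p + 1). set (eps := delta / P).
assert (HP : 0 < P) by (unfold P; generalize (Rabs_pos p); lra).
assert (He : 0 < eps) by (apply Rdiv_lt_0_compat; unfold delta; lra).
apply ex_series_le_R with (fun n => exp (- delta - P * ln eps) * exp (- delta) ^ n).
- intros n. assert (HQn : 0 < Q ^ (n + 1)) by (apply pow_lt; lra).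
  split.
  { apply Rmult_le_pos; left; [now apply Rinv_0_lt_compat|apply exp_pos]. }
  assert (Hn : 0 < INR (n + 1)) by (apply lt_0_INR; lia).
  assert (Hpow : forall x k, exp x ^ k = exp (INR k * x)).
  { intros x k. rewrite <- Rpower_pow by apply exp_pos. unfold Rpower. now rewrite ln_exp. }
  replace (/ Q ^ (n + 1)) with (exp (- (INR (n + 1) * ln Q))).
  2: { rewrite exp_Ropp, <- Hpow, exp_ln by lra. reflexivity. }
  rewrite Hpow, <- !exp_plus. apply exp_le_mono.
  assert (Hln0 := ln_INR_nonneg (n + 1) ltac:(lia)).
  assert (h1 : p * ln (INR (n + 1)) <= P * ln (INR (n + 1))).
  { apply Rmult_le_compat_r; [exact Hln0|]. unfold P. generalize (Rle_abs p); lra. }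
  assert (h2 : ln (INR (n + 1)) <= eps * INR (n + 1) - ln eps).
  { assert (H := exp_ineq1_le (ln (eps * INR (n + 1)))).
    rewrite exp_ln, ln_mult in H by nra. lra. }
  assert (h3 : P * ln (INR (n + 1)) <= delta * INR (n + 1) - P * ln eps).
  { apply Rle_trans with (P * (eps * INR (n + 1) - ln eps)); [apply Rmult_le_compat_l; lra|].
    apply Req_le. unfold eps at 1. field. lra. }
  assert (hn : INR (n + 1) = INR n + 1) by (rewrite plus_INR; reflexivity).
  assert (hd : ln Q = 2 * delta) by (unfold delta; field).
  rewrite hd, hn in *. nra.
- apply (ex_series_scal (V := R_NormedModule)). apply ex_series_geom.
  rewrite Rabs_pos_eq by (left; apply exp_pos). rewrite <- exp_0.
  apply exp_increasing. unfold delta. lra.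
Qed.

(** * The function eta *)

Definition eta_coef (Q : R) (n : nat) : C := RtoC ((-1) ^ n * / Q ^ (n + 1)).

Lemma eta_term_npow (Q : R) (s : C) (n : nat) :
  eta_term Q s (n + 1) = (eta_coef Q n * npow s (n + 1))%C.
Proof.
unfold eta_term, eta_coef, Cdiv. rewrite inv_Cpower_INR by lia.
now rewrite Nat.add_sub.
Qed.

Lemma Cmod_eta_coef (Q : R) (n : nat) : 1 < Q -> Cmod (eta_coef Q n) = / Q ^ (n + 1).
Proof.
intros HQ. unfold eta_coef. rewrite Cmod_R, Rabs_mult, pow_1_abs, Rmult_1_l.
apply Rabs_pos_eq. left. apply Rinv_0_lt_compat, pow_lt. lra.
Qed.

Lemma eta_coef_rapidly_decreasing (Q : R) : 1 < Q -> rapidly_decreasing (eta_coef Q).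
Proof.
intros HQ p. eapply ex_series_ext; [|apply (ex_series_geom_power Q p HQ)].
intros n. now rewrite Cmod_eta_coef.
Qed.

Lemma eta_dirichlet (Q : R) (s : C) : eta Q s = dirichlet_series (eta_coef Q) s.
Proof. apply CSeries_ext. intros n. apply eta_term_npow. Qed.

Lemma eta_ex_derive (Q : R) (s : C) : 1 < Q ->
  ex_derive (K := C_AbsRing) (V := C_NormedModule) (eta Q) s.
Proof.
intros HQ. apply ex_derive_ext with (dirichlet_series (eta_coef Q)).
- intros t. symmetry. apply eta_dirichlet.
- apply ex_derive_dirichlet_series. now apply eta_coef_rapidly_decreasing.
Qed.

(** An alternating series with decreasing terms is at most its third partial sum
    1/Q - 1/(2 Q^2) + 1/(3 Q^3), which is less than 1/Q. *)
Lemma eta_1_lt (Q : R) : 1 < Q -> Re (eta Q 1) < 1 / Q.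
Proof.
intros HQ.
assert (Hs := CSeries_correct _ (rapidly_decreasing_summable _ (RtoC 1) (eta_coef_rapidly_decreasing Q HQ))).
change (CSeries _) with (dirichlet_series (eta_coef Q) 1) in Hs.
rewrite <- eta_dirichlet in Hs.
apply is_series_C_components in Hs. destruct Hs as [Hs _].
set (U := fun n => / (Q ^ (n + 1) * INR (n + 1))).
assert (Hpos : forall n, 0 < Q ^ (n + 1) * INR (n + 1)).
{ intros n. apply Rmult_lt_0_compat; [apply pow_lt; lra|apply lt_0_INR; lia]. }
assert (HU : is_series (tg_alt U) (Re (eta Q 1))).
{ eapply is_series_ext; [|exact Hs]. intros n. unfold tg_alt, U, eta_coef, npow.
  assert (Hn : 0 < INR (n + 1)) by (apply lt_0_INR; lia).
  replace (- (1 * RtoC (ln (INR (n + 1)))))%C with (RtoC (- ln (INR (n + 1)))).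
  2: { rewrite RtoC_opp. ring. }
  rewrite Cexp_RtoC, <- RtoC_mult, re_RtoC, exp_Ropp, exp_ln by exact Hn.
  rewrite Rinv_mult. apply Rmult_assoc. }
assert (Hdec : Un_decreasing U).
{ intros n. apply Rinv_le_contravar; [apply Hpos|].
  change (S n + 1)%nat with (S (n + 1)).
  assert (Hq : 0 < Q ^ (n + 1)) by (apply pow_lt; lra).
  apply Rmult_le_compat; try lra; try apply pos_INR.
  - simpl. nra.
  - apply le_INR; lia. }
assert (Hlim : Un_cv U 0).
{ apply is_lim_seq_Reals. apply (is_lim_seq_ext (fun n => Rabs (U n))).
  - intros n. apply Rabs_pos_eq. left. apply Rinv_0_lt_compat, Hpos.
  - assert (H := ex_series_lim_0 _ (ex_intro _ _ HU)).
    apply is_lim_seq_abs_0 in H. revert H. apply is_lim_seq_ext. intros n.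
    unfold tg_alt. now rewrite Rabs_mult, pow_1_abs, Rmult_1_l. }
apply is_series_Reals in HU.
destruct (alternated_series_ineq U _ 1 Hdec Hlim HU) as [_ H].
apply Rle_lt_trans with (1 := H). unfold tg_alt, U. simpl.
apply Rlt_0_minus.
replace (1 / Q - _) with ((/ (Q * Q)) * (/ 2 - / 3 * / Q)) by (field; lra).
apply Rmult_lt_0_compat.
- apply Rinv_0_lt_compat. nra.
- assert (/ Q < 1) by (rewrite <- Rinv_1; apply Rinv_lt_contravar; lra). lra.
Qed.

(** * Singularities of the products *)

Lemma Re_zeta_ge (t : R) : 0 < t -> / t <= Re (zeta (RtoC (1 + t))).
Proof.
intros Ht. apply Rle_trans with (1 := Series_power_ge t Ht).
rewrite zeta_npow.
change (Re (CSeries ?f)) with (Series (fun n => Re (f n))). apply Req_le, Series_ext. intros n. unfold npow.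
replace (- (RtoC (1 + t) * RtoC (ln (INR (n + 1)))))%C with (RtoC (- ((1 + t) * ln (INR (n + 1))))).
- now rewrite Cexp_RtoC.
- now rewrite RtoC_opp, RtoC_mult.
Qed.

Lemma holomorphic_at_continuous (f : C -> C) (a : C) :
  holomorphic_at f a ->
  forall eps : posreal, @locally C_UniformSpace a (fun z => Cmod (f z - f a) < eps).
Proof.
intros H eps.
assert (Hd := ex_derive_continuous (K := C_AbsRing) (V := C_NormedModule) f a (locally_singleton _ _ H)).
apply locally_C.
apply (Hd (fun w => Cmod (w - f a) < eps)).
apply locally_C.
exists eps. intros w Hw. exact Hw.
Qed.

(** The general product rule is about the ring C as a module over itself; C also
    carries the normed module structure whose uniform structure is the product
    one.  The two norms agree, and this lemma transports the rule. *)
Lemma is_derive_C_mult (f g : C -> C) (x df dg : C) :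
  is_derive (K := C_AbsRing) (V := C_NormedModule) f x df ->
  is_derive (K := C_AbsRing) (V := C_NormedModule) g x dg ->
  is_derive (K := C_AbsRing) (V := C_NormedModule)
    (fun z => f z * g z)%C x (df * g x + f x * dg)%C.
Proof.
intros [_ Hf] [_ Hg].
assert (H : is_derive (K := C_AbsRing) (V := AbsRing_NormedModule C_AbsRing)
  (fun z => f z * g z)%C x (df * g x + f x * dg)%C).
{ apply (is_derive_mult (K := C_AbsRing) f g x df dg); [| |apply Cmult_comm].
  - split; [apply is_linear_scal_l|exact Hf].
  - split; [apply is_linear_scal_l|exact Hg]. }
destruct H as [_ H]. split; [apply is_linear_scal_l|exact H].
Qed.

Definition unbounded_right_of_1 (W : C -> C) : Prop :=
  forall M : R, exists delta : posreal, forall t : R, 0 < t < delta -> M < Cmod (W (RtoC (1 + t))).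

(** Away from 1 the product itself is a holomorphic extension.  At 1 a holomorphic
    extension g would be bounded near 1, while |E| stays above |E(1)| / 2; this
    bounds W on the real axis just to the right of 1. *)
Lemma singular_at_product (k : R) (W E : C -> C) (a : C) :
  k <> 0 -> (forall s, ex_derive (K := C_AbsRing) (V := C_NormedModule) E s) -> E (RtoC 1) <> 0%C ->
  (forall s, s <> RtoC 1 -> holomorphic_at W s) -> unbounded_right_of_1 W ->
  (singular_at (fun s => RtoC k * W s * E s)%C a <-> a = RtoC 1).
Proof.
intros Hk HE HE1 HW Hub. split.
- intros Hs. destruct (Ceq_dec a (RtoC 1)) as [Ha|Ha]; [exact Ha|].
  exfalso. apply Hs. exists (fun s => RtoC k * W s * E s)%C. split.
  + assert (HWa := HW a Ha). unfold holomorphic_at in *. revert HWa. apply filter_imp. intros z Hz.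
    destruct (HE z) as [dE HdE]. destruct Hz as [dW HdW].
    eexists. apply is_derive_C_mult; [|exact HdE].
    apply (is_derive_C_mult (fun _ => RtoC k) W); [|exact HdW].
    apply (is_derive_const (K := C_AbsRing) (V := C_NormedModule)).
  + apply filter_forall. reflexivity.
- intros -> [g [Hg Heq]].
  assert (Hc := holomorphic_at_continuous g _ Hg (mkposreal 1 Rlt_0_1)).
  assert (He1 : 0 < Cmod (E (RtoC 1))) by now apply Cmod_gt_0.
  assert (HcE := holomorphic_at_continuous E _ (entire_of_ex_derive E HE (RtoC 1)) (pos_div_2 (mkposreal _ He1))).
  assert (Hk' : 0 < Rabs k) by now apply Rabs_pos_lt.
  destruct (Hub ((Cmod (g (RtoC 1)) + 1) / (Rabs k * (Cmod (E (RtoC 1)) / 2)))) as [d1 Hd1].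
  destruct (filter_and _ _ Hc (filter_and _ _ HcE Heq)) as [d2 Hd2].
  set (t := Rmin d1 d2 / 2).
  assert (Ht0 : 0 < Rmin d1 d2) by (apply Rmin_pos; apply cond_pos).
  assert (Ht : 0 < t < d1 /\ t < d2).
  { unfold t. generalize (Rmin_l d1 d2) (Rmin_r d1 d2). lra. }
  specialize (Hd1 t (proj1 Ht)).
  destruct (Hd2 (RtoC (1 + t))) as [h1 [h2 h3]].
  { split.
    - change (Rabs ((1 + t) - 1) < d2). rewrite Rabs_pos_eq; lra.
    - change (Rabs (0 - 0) < d2). rewrite Rminus_0_r, Rabs_R0. apply cond_pos. }
  rewrite h3 in h1. 2: { intros H. apply RtoC_inj in H. lra. }
  simpl in h1, h2.
  set (w := W (RtoC (1 + t))) in *. set (e := E (RtoC (1 + t))) in *.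
  assert (He : Cmod (E (RtoC 1)) / 2 <= Cmod e).
  { assert (H := Cmod_triangle e (- (e - E (RtoC 1)))).
    rewrite Cmod_opp in H. replace (e + - (e - E (RtoC 1)))%C with (E (RtoC 1)) in H by ring. lra. }
  assert (Hg1 : Cmod (RtoC k * w * e) < Cmod (g (RtoC 1)) + 1).
  { assert (H := Cmod_triangle (g (RtoC 1)) (RtoC k * w * e - g (RtoC 1))).
    replace (g (RtoC 1) + (RtoC k * w * e - g (RtoC 1)))%C with (RtoC k * w * e)%C in H by ring. lra. }
  rewrite !Cmod_mult, Cmod_R in Hg1.
  apply (Rmult_lt_compat_r (Rabs k * (Cmod (E (RtoC 1)) / 2))) in Hd1; [|nra].
  replace ((Cmod (g (RtoC 1)) + 1) / (Rabs k * (Cmod (E (RtoC 1)) / 2)) * (Rabs k * (Cmod (E (RtoC 1)) / 2)))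
    with (Cmod (g (RtoC 1)) + 1) in Hd1 by (field; lra).
  assert (Hw := Cmod_ge_0 w).
  assert (Rabs k * Cmod w * (Cmod (E (RtoC 1)) / 2) <= Rabs k * Cmod w * Cmod e).
  { apply Rmult_le_compat_l; [nra|exact He]. }
  lra.
Qed.

(** Subtracting the constant c covers the factors zeta and zeta - 1 together. *)
Lemma zeta_unbounded (Z : C -> C) (c : C) :
  (forall s : C, 1 < Re s -> Z s = zeta s) -> unbounded_right_of_1 (fun s => Z s - c)%C.
Proof.
intros HZ M. set (M' := Rmax M 0 + Cmod c + 1).
assert (HM : 0 < M').
{ unfold M'. generalize (Cmod_ge_0 c) (Rmax_r M 0). lra. }
exists (mkposreal _ (Rinv_0_lt_compat _ HM)). intros t [Ht1 Ht2]. simpl in Ht2.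
assert (Hz : M' < Cmod (Z (RtoC (1 + t)))).
{ rewrite HZ by (simpl; lra). apply Rlt_le_trans with (/ t).
  - rewrite <- (Rinv_inv M'). apply Rinv_lt_contravar; [|exact Ht2].
    apply Rmult_lt_0_compat; [exact Ht1|now apply Rinv_0_lt_compat].
  - apply Rle_trans with (1 := Re_zeta_ge t Ht1).
    apply Rle_trans with (1 := Rle_abs _). apply re_le_Cmod. }
assert (H := Cmod_triangle (Z (RtoC (1 + t)) - c) c).
replace (Z (RtoC (1 + t)) - c + c)%C with (Z (RtoC (1 + t))) in H by ring.
unfold M' in Hz. generalize (Rmax_l M 0). lra.
Qed.

(** * The Dirichlet series of frakS and frakF *)

Definition qcoef (Q : R) (i : nat) : C := RtoC (/ (- Q) ^ i).

Lemma Cmod_qcoef (Q : R) (i : nat) : 1 < Q -> Cmod (qcoef Q i) = (/ Q) ^ i.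
Proof.
intros HQ. unfold qcoef. rewrite Cmod_R, Rabs_inv, <- RPow_abs, Rabs_Ropp, Rabs_pos_eq by lra.
symmetry. apply pow_inv.
Qed.

Lemma qcoef_summable (Q : R) : 1 < Q -> abs_summable (fun i => qcoef Q (i + 2)).
Proof.
intros HQ. apply abs_summable_le with (fun i => (/ Q) ^ 2 * (/ Q) ^ i).
- intros i. rewrite Cmod_qcoef, pow_add by exact HQ. apply Req_le, Rmult_comm.
- apply (ex_series_scal (V := R_NormedModule)). apply ex_series_geom.
  rewrite Rabs_pos_eq by (left; apply Rinv_0_lt_compat; lra).
  rewrite <- Rinv_1. apply Rinv_lt_contravar; lra.
Qed.

Lemma frakS_term_INR (Q : R) (n i : nat) : (0 < i)%nat ->
  frakS_term (INR n) Q i = on_multiples i n (qcoef Q i).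
Proof.
intros Hi. assert (Hi' : INR i <> 0) by (apply not_0_INR; lia).
assert (Hi2 : (RtoC (INR i) ^ 2)%C <> 0%C).
{ apply Cpow_nz. intros H. apply RtoC_inj in H. now apply Hi'. }
unfold frakS_term, on_multiples, qcoef.
destruct (Nat.eq_dec (n mod i) 0) as [H|H].
- rewrite F_INR_divide by (trivial; now apply Nat.Lcm0.mod_divide).
  rewrite RtoC_pow. field. intros H0. apply RtoC_inj in H0. now apply Hi'.
- rewrite F_INR_not_divide; [|exact Hi|].
  + unfold Cdiv. now rewrite !Cmult_0_l.
  + intros Hd. apply H. now apply Nat.Lcm0.mod_divide.
Qed.

Lemma frakS_INR (Q : R) (n : nat) :
  frakS (INR n) Q = (RtoC (Q * (Q + 1)) *
    CSeries (fun i => on_multiples (i + 2) n (qcoef Q (i + 2))))%C.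
Proof.
unfold frakS. f_equal. apply CSeries_ext. intros i. apply frakS_term_INR. lia.
Qed.

(** The n-th coefficient of eta is the opposite of (-Q)^(-n), so removing the
    first term 1/Q from eta leaves the opposite of this series. *)
Lemma eta_tail (Q : R) (s : C) : 1 < Q ->
  is_series (fun i => qcoef Q (i + 2) * npow s (i + 2))%C (RtoC (1 / Q) - eta Q s)%C.
Proof.
intros HQ.
assert (H := CSeries_correct _ (rapidly_decreasing_summable _ s (eta_coef_rapidly_decreasing Q HQ))).
change (CSeries _) with (dirichlet_series (eta_coef Q) s) in H.
rewrite <- eta_dirichlet in H.
assert (H' : is_series (fun n => eta_coef Q (S n) * npow s (S n + 1))%C (eta Q s - RtoC (1 / Q))%C).
{ apply (is_series_incr_1 (V := C_NormedModule) (fun n => eta_coef Q n * npow s (n + 1))%C).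
  match goal with |- is_series _ ?l => replace l with (eta Q s); [exact H|] end.
  simpl (0 + 1)%nat. rewrite npow_1. unfold eta_coef. simpl.
  replace (1 * / (Q * 1)) with (1 / Q) by (field; lra).
  change (eta Q s = eta Q s - RtoC (1 / Q) + RtoC (1 / Q) * 1)%C. ring. }
apply is_series_opp in H'.
replace (RtoC (1 / Q) - eta Q s)%C with (- (eta Q s - RtoC (1 / Q)))%C by ring.
revert H'. apply is_series_ext. intros i.
replace (S i + 1)%nat with (i + 2)%nat by lia.
unfold eta_coef, qcoef. change (- (RtoC ((-1) ^ S i * / Q ^ (S i + 1)) * npow s (i + 2)) =
  RtoC (/ (- Q) ^ (i + 2)) * npow s (i + 2))%C.
replace (/ (- Q) ^ (i + 2)) with (- ((-1) ^ S i * / Q ^ (S i + 1))).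
- rewrite RtoC_opp. ring.
- replace (S i + 1)%nat with (i + 2)%nat by lia.
  replace (- Q) with (-1 * Q) by ring. rewrite Rpow_mult_distr, Rinv_mult, <- (pow_inv (-1)).
  replace (/ -1) with (-1) by field.
  generalize (/ Q ^ (i + 2)). intros x. rewrite pow_add. simpl. ring.
Qed.

Lemma frakS_series (Q : R) (s : C) : 1 < Q -> 1 < Re s ->
  is_series (fun n => (frakS (INR (n + 2)) Q / Cpower (INR (n + 2)) s)%C)
    (RtoC (Q * (Q + 1)) * zeta s * (RtoC (1 / Q) - eta Q s))%C.
Proof.
intros HQ Hs.
assert (H := divisor_sum_dirichlet (qcoef Q) s (qcoef_summable Q HQ) Hs).
rewrite (CSeries_unique _ _ (eta_tail Q s HQ)) in H.
apply (is_series_scal (RtoC (Q * (Q + 1)))) in H.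
replace (RtoC (Q * (Q + 1)) * zeta s * (RtoC (1 / Q) - eta Q s))%C
  with (scal (RtoC (Q * (Q + 1))) ((RtoC (1 / Q) - eta Q s) * zeta s)%C).
- revert H. apply is_series_ext. intros n.
  unfold Cdiv. rewrite inv_Cpower_INR, frakS_INR by lia. apply Cmult_assoc.
- change (RtoC (Q * (Q + 1)) * ((RtoC (1 / Q) - eta Q s) * zeta s) =
    RtoC (Q * (Q + 1)) * zeta s * (RtoC (1 / Q) - eta Q s))%C. ring.
Qed.

(** The power subtracted in frakF is the contribution of the divisor i = n to
    frakS, so the Dirichlet series of frakF is that of frakS minus a multiple of
    the tail of eta. *)
Lemma frakF_INR_div (Q : R) (s : C) (n : nat) : 1 < Q ->
  (frakF (INR (n + 2)) Q / Cpower (INR (n + 2)) s)%C =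
  (frakS (INR (n + 2)) Q / Cpower (INR (n + 2)) s -
   RtoC (Q * (Q + 1)) * (qcoef Q (n + 2) * npow s (n + 2)))%C.
Proof.
intros HQ. unfold frakF, Cdiv. rewrite inv_Cpower_INR by lia.
rewrite Cpower_neg_INR by lra. unfold qcoef. ring.
Qed.

Lemma frakF_series (Q : R) (s : C) : 1 < Q -> 1 < Re s ->
  is_series (fun n => (frakF (INR (n + 2)) Q / Cpower (INR (n + 2)) s)%C)
    (RtoC (Q * (Q + 1)) * (zeta s - 1) * (RtoC (1 / Q) - eta Q s))%C.
Proof.
intros HQ Hs.
assert (H := is_series_minus _ _ _ _ (frakS_series Q s HQ Hs)
  (is_series_scal (RtoC (Q * (Q + 1))) _ _ (eta_tail Q s HQ))).
match type of H with is_series _ ?l =>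
  replace (RtoC (Q * (Q + 1)) * (zeta s - 1) * (RtoC (1 / Q) - eta Q s))%C with l end.
- revert H. apply is_series_ext. intros n. symmetry. now apply frakF_INR_div.
- change (RtoC (Q * (Q + 1)) * zeta s * (RtoC (1 / Q) - eta Q s) +
    - (RtoC (Q * (Q + 1)) * (RtoC (1 / Q) - eta Q s)) =
    RtoC (Q * (Q + 1)) * (zeta s - 1) * (RtoC (1 / Q) - eta Q s))%C. ring.
Qed.

(** The values frakS(n) are bounded, since all of them are sums of subfamilies of
    one absolutely convergent series. *)
Lemma frakS_series_abs (Q : R) (s : C) : 1 < Q -> 1 < Re s ->
  abs_summable (fun n => (frakS (INR (n + 2)) Q / Cpower (INR (n + 2)) s)%C).
Proof.
intros HQ Hs.
set (m := fun i => Cmod (qcoef Q (i + 2))).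
apply abs_summable_le with
  (fun n => Rabs (Q * (Q + 1)) * (2 * Series m) * Cmod (npow s (S n + 1))).
- intros n. unfold Cdiv. rewrite inv_Cpower_INR, frakS_INR by lia.
  replace (S n + 1)%nat with (n + 2)%nat by lia.
  rewrite !Cmod_mult, Cmod_R.
  apply Rmult_le_compat_r; [apply Cmod_ge_0|].
  apply Rmult_le_compat_l; [apply Rabs_pos|].
  apply Cmod_CSeries_le; [|exact (qcoef_summable Q HQ)].
  intros i. unfold on_multiples, m. destruct (Nat.eq_dec ((n + 2) mod (i + 2)) 0).
  + apply Rle_refl.
  + rewrite Cmod_0. apply Cmod_ge_0.
- apply (ex_series_scal (V := R_NormedModule)).
  apply (ex_series_incr_1 (fun n => Cmod (npow s (n + 1)))). now apply npow_summable.
Qed.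

Lemma frakF_series_abs (Q : R) (s : C) : 1 < Q -> 1 < Re s ->
  abs_summable (fun n => (frakF (INR (n + 2)) Q / Cpower (INR (n + 2)) s)%C).
Proof.
intros HQ Hs.
apply abs_summable_le with (fun n =>
  Cmod (frakS (INR (n + 2)) Q / Cpower (INR (n + 2)) s) +
  Rabs (Q * (Q + 1)) * Cmod (qcoef Q (n + 2))).
- intros n. rewrite frakF_INR_div by exact HQ.
  apply Rle_trans with (1 := Cmod_triangle _ _). apply Rplus_le_compat_l.
  rewrite Cmod_opp, !Cmod_mult, Cmod_R.
  apply Rmult_le_compat_l; [apply Rabs_pos|].
  rewrite <- Rmult_1_r. apply Rmult_le_compat_l; [apply Cmod_ge_0|].
  apply npow_le_1; [lra|lia].
- apply (ex_series_plus (V := R_NormedModule)); [now apply frakS_series_abs|].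
  apply (ex_series_scal (V := R_NormedModule)). now apply qcoef_summable.
Qed.

(** * The theorem *)

Theorem proposition6p24 (Q : R) (hQ : 1 < Q) :
  (* the two identities, sums over n >= 2 *)
  (forall s : C, 1 < Re s ->
     is_series (fun n => (frakS (INR (n + 2)) Q / Cpower (INR (n + 2)) s)%C)
               (RtoC (Q * (Q + 1)) * zeta s * (RtoC (1 / Q) - eta Q s))%C /\
     is_series (fun n => (frakF (INR (n + 2)) Q / Cpower (INR (n + 2)) s)%C)
               (RtoC (Q * (Q + 1)) * (zeta s - 1) * (RtoC (1 / Q) - eta Q s))%C) /\
  (* no Abel summation: |1/q| < 1 and all the series converge absolutely *)
  (Rabs (1 / - Q) < 1 /\
   (forall n : nat, (2 <= n)%nat ->
      abs_summable (fun i => frakS_term (INR n) Q (i + 2))) /\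
   (forall s : C, abs_summable (fun n => eta_term Q s (n + 1))) /\
   (forall s : C, 1 < Re s ->
      abs_summable (fun n => (frakS (INR (n + 2)) Q / Cpower (INR (n + 2)) s)%C) /\
      abs_summable (fun n => (frakF (INR (n + 2)) Q / Cpower (INR (n + 2)) s)%C))) /\
  (* the factor 1/Q - eta_Q is entire, and the right-hand sides, continued through
     zeta, are singular at 1 and nowhere else *)
  entire (eta Q) /\
  entire (fun s => RtoC (1 / Q) - eta Q s)%C /\
  (forall Z : C -> C, is_riemann_zeta Z ->
     forall a : C,
       (singular_at (fun s => RtoC (Q * (Q + 1)) * Z s * (RtoC (1 / Q) - eta Q s))%C a
          <-> a = RtoC 1) /\
       (singular_at (fun s => RtoC (Q * (Q + 1)) * (Z s - 1) * (RtoC (1 / Q) - eta Q s))%C a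
          <-> a = RtoC 1)).
Proof.
assert (HE : forall s : C, ex_derive (K := C_AbsRing) (V := C_NormedModule)
  (fun s => RtoC (1 / Q) - eta Q s)%C s).
{ intros s. apply (ex_derive_minus (K := C_AbsRing) (V := C_NormedModule)).
  - apply (ex_derive_const (K := C_AbsRing) (V := C_NormedModule)).
  - now apply eta_ex_derive. }
assert (Hk : Q * (Q + 1) <> 0) by nra.
assert (HE1 : (RtoC (1 / Q) - eta Q (RtoC 1))%C <> 0%C).
{ intros H. apply (f_equal Re) in H. change (1 / Q + - Re (eta Q 1) = 0) in H. generalize (eta_1_lt Q hQ). lra. }
split; [|split; [|split; [|split]]].
- intros s Hs. split; [now apply frakS_series|now apply frakF_series].
- split; [|split; [|split]].
  + unfold Rdiv. rewrite Rmult_1_l, Rabs_inv, Rabs_Ropp, Rabs_pos_eq by lra.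
    rewrite <- Rinv_1. apply Rinv_lt_contravar; lra.
  + intros n _. eapply ex_series_ext; [|apply (on_multiples_summable _ n (qcoef_summable Q hQ))].
    intros i. cbv beta. now rewrite frakS_term_INR by lia.
  + intros s. eapply ex_series_ext; [|apply (rapidly_decreasing_summable (eta_coef Q) s);
      now apply eta_coef_rapidly_decreasing].
    intros n. cbv beta. now rewrite eta_term_npow.
  + intros s Hs. split; [now apply frakS_series_abs|now apply frakF_series_abs].
- apply entire_of_ex_derive. intros s. now apply eta_ex_derive.
- now apply entire_of_ex_derive.
- intros Z [HZ HZ'] a. split.
  + apply (singular_at_product _ Z); trivial.
    intros M. destruct (zeta_unbounded Z 0 HZ M) as [d Hd]. exists d. intros t Ht.
    replace (Z (RtoC (1 + t))) with (Z (RtoC (1 + t)) - 0)%C by ring. now apply Hd.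
  + apply (singular_at_product _ (fun s => Z s - 1)%C); trivial.
    * intros s Hs. assert (HZs := HZ' s Hs). unfold holomorphic_at in *. revert HZs.
      apply filter_imp. intros z Hz.
      apply (ex_derive_minus (K := C_AbsRing) (V := C_NormedModule)); [exact Hz|].
      apply (ex_derive_const (K := C_AbsRing) (V := C_NormedModule)).
    * now apply zeta_unbounded.
Qed.
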